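(* Let $P_X$ be an $X$-profile where $X=\{x^*\}\cup\{x_1,\dots,x_p\}$ has $p+1$ elements, let $Y=\{y_1,\dots,y_k\}$ be a set of $k$ new candidates disjoint from $X$, and let $m=p+1+k$. Let $r_{\vec s}$ be a scoring rule for $m$ candidates defined by a vector $\vec s=\langle s_1,\dots,s_m\rangle$ such that $(s_i-s_{i+1})\leq(s_{i+1}-s_{i+2})$ for all $1\le i\le m-2$. Then $x^*$ is a possible cowinner for $P_X$ with respect to the addition of $k$ new candidates for the scoring rule $r_{\vec s}$ if and only if $x^*\in r_{\vec s}(P)$, where $P$ is the profile on $X\cup Y$ obtained from $P_X$ by putting $y_1,\dots,y_k$ right below $x^*$ (in arbitrary order) in every vote of $P_X$.
   Context: A vote over a finite candidate set $C$ is a linear order on $C$; a $C$-profile is a list $\langle V_1,\dots,V_n\rangle$ ($n\geq 1$) of votes over $C$. If $X\subseteq C$, a $C$-profile $P'=\langle V_1',\dots,V_n'\rangle$ extends an $X$-profile $P_X=\langle V_1,\dots,V_n\rangle$ if for each $i$ the restriction of $V_i'$ to $X$ is $V_i$. For a vector of integers $\vec s=\langle s_1,\dots,s_m\rangle$ with $s_1\geq\dots\geq s_m$ and $s_1>s_m$, the scoring rule $r_{\vec s}$ maps a profile $P$ over $m$ candidates to the set of candidates $x$ maximizing $S_{\vec s}(x,P)=\sum_{i=1}^m s_i\cdot n(P,i,x)$, where $n(P,i,x)$ is the number of votes of $P$ ranking $x$ in position $i$. A candidate $x^*\in X$ is a possible cowinner for $P_X$ and $r$ with respect to the addition of $k$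 new candidates if there is an $(X\cup Y)$-profile $P'$ extending $P_X$ with $x^*\in r(P')$, where $Y=\{y_1,\dots,y_k\}$ is a set of $k$ candidates disjoint from $X$. *)

(* Defs.v *)
From mathcomp Require Import all_boot all_order all_algebra.

Set Implicit Arguments.
Unset Strict Implicit.
Unset Printing Implicit Defensive.

Import Order.TTheory GRing.Theory Num.Theory.

(* Candidates live in an ambient finite type T; candidate sets are {set T}.
   The values of a vote over C at candidates outside C are irrelevant. *)

Definition linear_on (T : finType) (C : {set T}) (R : rel T) : Prop :=
  [/\ {in C, reflexive R}, {in C &, antisymmetric R},
      {in C & &, transitive R} & {in C &, total R}].

(* [V a b] reads "a = b, or V ranks a above b". *)
Record vote (T : finType) (C : {set T}) := Vote {
  prefers :> rel T;
  voteP : linear_on C prefers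
}.

Notation profile n C := (n.-tuple (vote C)).

Definition extends (T : finType) (X C : {set T}) (n : nat)
    (P' : profile n C) (PX : profile n X) : Prop :=
  forall i : 'I_n, {in X &, forall a b, tnth P' i a b = tnth PX i a b}.

(* Positions are numbered from 0, as are the entries of a scoring vector: the
   top candidate of V has position 0 and earns s`_0. *)
Definition position (T : finType) (C : {set T}) (V : vote C) (x : T) : nat :=
  #|[set y in C | (y != x) && V y x]|.

Definition npos (T : finType) (C : {set T}) (n : nat)
    (P : profile n C) (i : nat) (x : T) : nat :=
  count (fun V : vote C => position V x == i) P.

Local Open Scope ring_scope.

Definition scoring_vector (m : nat) (s : m.-tuple int) : Prop :=
  (forall i : nat, (i.+1 < m)%N -> s`_i.+1 <= s`_i) /\ s`_m.-1 < s`_0.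

Definition score (m : nat) (s : m.-tuple int) (T : finType) (C : {set T})
    (n : nat) (x : T) (P : profile n C) : int :=
  \sum_(i < m) s`_i * (npos P i x)%:Z.

Definition scoring_rule (m : nat) (s : m.-tuple int) (T : finType)
    (C : {set T}) (n : nat) (P : profile n C) : {set T} :=
  [set x in C | [forall y in C, score s y P <= score s x P]].

Local Close Scope ring_scope.

Definition possible_cowinner (T : finType) (X Y : {set T}) (n : nat)
    (PX : profile n X) (r : profile n (X :|: Y) -> {set T}) (x : T) : Prop :=
  exists P' : profile n (X :|: Y), extends P' PX /\ x \in r P'.

(* P is obtained from PX by putting Y right below x in every vote: the order
   on X is kept, and Y fills the #|Y| positions following that of x, in an
   arbitrary order that may differ from vote to vote. *)
Definition put_right_below (T : finType) (X Y : {set T}) (n : nat)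
    (PX : profile n X) (x : T) (P : profile n (X :|: Y)) : Prop :=
  extends P PX /\
  forall i : 'I_n, {in Y, forall y,
    position (tnth P i) x < position (tnth P i) y
      <= position (tnth P i) x + #|Y|}.

Section Existence.
Variables (T : finType) (X Y : {set T}) (x : T).
Hypotheses (Xx : x \in X) (dXY : [disjoint X & Y]).

Definition insert_rel (V : rel T) : rel T := fun a b =>
  if a \in X then (if b \in X then V a b else V a x)
  else (if b \in X then ~~ V b x else enum_rank a <= enum_rank b).

Lemma insert_rel_linear (V : vote X) : linear_on (X :|: Y) (insert_rel V).
Proof.
case: (V) => R [rR aR tR oR] /=; rewrite /insert_rel; split.
- by move=> a _ /=; case aX: (a \in X); rewrite ?leqnn ?rR.
- move=> a b _ _ /=; case aX: (a \in X); case bX: (b \in X).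
  + exact: aR.
  + by rewrite andbN.
  + by rewrite andNb.
  + by rewrite -eqn_leq => /eqP/val_inj/enum_rank_inj.
- move=> b a c _ _ _; case aX: (a \in X); case bX: (b \in X); case cX: (c \in X) => //.
  + exact: tR.
  + exact: tR.
  + move=> ax ncx; have /orP[//|ca] := oR _ _ aX cX.
    by rewrite (tR _ _ _ aX cX Xx ca ax) in ncx.
  + move=> nbx bc; apply/negP => cx.
    by rewrite (tR _ _ _ cX bX Xx bc cx) in nbx.
  + by move=> nbx bx; rewrite bx in nbx.
  + exact: leq_trans.
- move=> a b _ _ /=; case aX: (a \in X); case bX: (b \in X).
  + exact: oR.
  + by rewrite orbN.
  + by rewrite orNb.
  + exact: leq_total.
Qed.

Definition insert_vote (V : vote X) : vote (X :|: Y) :=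
  Vote (insert_rel_linear V).

Lemma insert_voteP (V : vote X) (y : T) : y \in Y ->
  position (insert_vote V) x < position (insert_vote V) y
    <= position (insert_vote V) x + #|Y|.
Proof.
move=> Yy; have Y'X a : a \in Y -> a \in X = false.
  by move=> Ya; apply/negbTE; rewrite (disjointFl dXY Ya).
have [rR _ _ _] := voteP V; have Vxx := rR x Xx.
have nxy : x != y by apply: contraTneq Xx => ->; rewrite Y'X.
rewrite /position /= /insert_rel Xx (Y'X y Yy).
set A := [set _ in _ | _]; set B := [set _ in _ | _].
have sAB : x |: A \subset B.
  apply/subsetP => a; rewrite !inE => /predU1P[->|]; first by rewrite Xx nxy.
  case/and3P=> aXY nax; case aX: (a \in X) => Vax; last by rewrite Vxx in Vax.
  by rewrite Vax /= andbT; apply: contraTneq aX => ->; rewrite Y'X.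
have xA : x \notin A by rewrite !inE eqxx andbF.
apply/andP; split.
  by apply: leq_trans (subset_leq_card sAB); rewrite cardsU1 xA.
have sBA : B \subset (x |: A) :|: (Y :\ y).
  apply/subsetP => a; rewrite !inE => /and3P[aXY nay].
  case aX: (a \in X) aXY => /= aY; last by rewrite nay aY orbT.
  by move=> ->; case: eqVneq.
apply: leq_trans (subset_leq_card sBA) _.
apply: leq_trans (leq_card_setU _ _) _.
by rewrite cardsU1 xA (cardsD1 y Y) Yy addnCA.
Qed.

Lemma put_right_below_exists (n : nat) (PX : profile n X) :
  exists P : profile n (X :|: Y), put_right_below PX x P.
Proof.
exists (map_tuple insert_vote PX); split=> i; last first.
  by move=> y Yy; rewrite tnth_map insert_voteP.
by move=> a b aX bX; rewrite tnth_map /= /insert_rel aX bX.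
Qed.

End Existence.

(* Main.v *)
(** Fix an extension P' and an old candidate x <> x*, and compare P' with P one
    vote at a time, through the margin of x* over x.  If x* is ranked above x,
    then P moves x* up and x down, so by monotonicity the margin grows.  If x is
    ranked above x*, then P' shifts x down by some u and x* by some v >= u, and
    as the gaps of s increase down the vector the deficit of x* is smallest
    without any shift, which is its value in P.  The new candidates are always
    below x* in P. *)
Require Import Defs.
From mathcomp Require Import all_boot all_order all_algebra.
From mathcomp Require Import zify lra.

Set Implicit Arguments.
Unset Strict Implicit.
Unset Printing Implicit Defensive.

Import Order.TTheory GRing.Theory Num.Theory.

(** By transitivity everything above the higher candidate is also above the lower one, and the
    higher one itself makes the inclusion strict. Totality gives the converse. *)
Lemma position_ltP (T : finType) (C : {set T}) (V : vote C) (a b : T) :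
  a \in C -> b \in C -> (position V a < position V b) = (a != b) && V a b.
Proof.
have [_ aV tV oV] := voteP V.
have above c d : c \in C -> d \in C -> c != d -> V c d ->
    position V c < position V d.
  move=> Cc Cd ncd Vcd; apply: proper_card; apply/properP; split.
    apply/subsetP=> z; rewrite !inE => /and3P[Cz nzc Vzc].
    rewrite Cz (tV _ _ _ Cc Cz Cd Vzc Vcd) andbT /=.
    apply: contraNneq nzc => ezd; rewrite ezd in Vzc *.
    by apply/eqP; apply: aV; rewrite // Vzc.
  by exists c; rewrite !inE ?Cc ?ncd ?Vcd // eqxx andbF.
move=> Ca Cb; case: eqVneq => [->|nab] /=; first by rewrite ltnn.
apply/idP/idP=> [ltab|]; last exact: above.
have /orP[//|Vba] := oV a b Ca Cb.
by have := above _ _ Cb Ca; rewrite eq_sym => /(_ nab Vba)/(ltn_trans ltab); rewrite ltnn.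
Qed.

Lemma position_inj (T : finType) (C : {set T}) (V : vote C) :
  {in C &, injective (position V)}.
Proof.
move=> a b Ca Cb eab; apply/eqP; apply: contraT => nab.
have [_ _ _ /(_ a b Ca Cb)/orP[Vab|Vba]] := voteP V.
  by have := position_ltP V Ca Cb; rewrite eab ltnn nab Vab.
by have := position_ltP V Cb Ca; rewrite eab ltnn eq_sym nab Vba.
Qed.

Lemma position_lt_card (T : finType) (C : {set T}) (V : vote C) (x : T) :
  x \in C -> position V x < #|C|.
Proof.
move=> Cx; apply: proper_card; apply/properP; split.
  by apply/subsetP=> z; rewrite inE => /andP[].
by exists x; rewrite // inE eqxx andbF.
Qed.

(** The old candidates above [x] are the same in both votes, so only new candidates can shift [x]
    down. These shifts are what [margin_le] compares. *)
Lemma position_extension (T : finType) (X Y : {set T}) (V : vote X)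
    (W : vote (X :|: Y)) (x : T) :
  [disjoint X & Y] -> {in X &, forall a b, W a b = V a b} -> x \in X ->
  position W x = position V x + #|[set y in Y | W y x]|.
Proof.
move=> dXY eWV Xx; rewrite /position -cardsUI.
set A := [set y in X | _]; set B := [set y in Y | _].
have -> : A :&: B = set0.
  apply/setP=> z; rewrite !inE; case Xz: (z \in X) => //=.
  by rewrite (disjointFr dXY Xz) andbF.
rewrite cards0 addn0; apply: eq_card => z; rewrite !inE.
case Xz: (z \in X); first by rewrite (disjointFr dXY Xz) eWV ?orbF.
by case: eqVneq => //= ezx; rewrite ezx Xx in Xz.
Qed.

Lemma right_below_block (T : finType) (X Y : {set T}) (W : vote (X :|: Y))
    (x z y : T) :
  [disjoint X & Y] -> x \in X -> z \in X ->
  {in Y, forall y, position W x < position W y <= position W x + #|Y|} ->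
  position W x < position W z -> y \in Y -> W y z.
Proof.
move=> dXY Xx Xz bW ltxz Yy.
have Cy : y \in X :|: Y by rewrite inE Yy orbT.
have Cz : z \in X :|: Y by rewrite inE Xz.
suff : position W y < position W z by rewrite position_ltP // => /andP[].
have nYz : z \notin Y by rewrite (disjointFr dXY Xz).
have /andP[_ leyk] := bW y Yy; apply: leq_ltn_trans leyk _.
rewrite ltnNge; apply/negP => lezk.
(* Otherwise z and the elements of Y share the #|Y| positions following x. *)
have inj : {in z :: enum Y &, injective (position W)}.
  have sC a : a \in z :: enum Y -> a \in X :|: Y.
    by rewrite !inE mem_enum => /predU1P[->|->]; rewrite ?Xz ?orbT.
  by move=> a b /sC Ca /sC Cb; apply: position_inj.
have : size (map (position W) (z :: enum Y)) <= size (iota (position W x).+1 #|Y|).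
  apply: uniq_leq_size.
    by rewrite map_inj_in_uniq //= mem_enum nYz enum_uniq.
  move=> i /mapP[a]; rewrite inE mem_enum mem_iota => /predU1P[->|Ya] ->; first lia.
  by have := bW a Ya; lia.
by rewrite size_map size_iota /= -cardE ltnn.
Qed.

Local Open Scope ring_scope.

(** Regrouping the count by position into a sum over votes makes it possible to compare two profiles
    one vote at a time. *)
Lemma score_sum (m : nat) (s : m.-tuple int) (T : finType) (C : {set T})
    (n : nat) (x : T) (P : profile n C) :
  #|C| = m -> x \in C ->
  score s x P = \sum_(j < n) s`_(position (tnth P j) x).
Proof.
move=> cardC Cx; rewrite /score.
rewrite -(big_tuple _ _ P xpredT (fun V => s`_(position V x))) /npos.
elim: (tval P) => [|V r IHr]; first by rewrite big_nil big1 // => i _; rewrite mulr0.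
rewrite big_cons -IHr /=.
(* The vote [V] contributes only through the index [position V x], which has to lie in the range of
   the sum. *)
have ltm : (position V x < m)%N by rewrite -cardC position_lt_card.
rewrite (bigD1 (Ordinal ltm)) //= [in RHS](bigD1 (Ordinal ltm)) //= eqxx.
rewrite PoszD mulrDr mulr1 addrA; congr (_ + _).
apply: eq_bigr => i; rewrite -val_eqE /= eq_sym => /negbTE->.
by rewrite add0n.
Qed.

Lemma scoring_vector_le (m : nat) (s : m.-tuple int) (i j : nat) :
  scoring_vector s -> (i <= j)%N -> (j < m)%N -> s`_j <= s`_i.
Proof.
move=> [decr _]; elim: j => [|j IHj]; first by rewrite leqn0 => /eqP->.
rewrite leq_eqVlt => /predU1P[->//|leij] ltjm.
exact: le_trans (decr j ltjm) (IHj leij (ltnW ltjm)).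
Qed.

(** Moving both indices down by one adds the gap at the lower position and removes the gap at the
    higher one. Gaps grow down the vector, so each such move can only increase the difference. *)
Lemma gap_shift (m : nat) (s : m.-tuple int) (i j u : nat) :
  (forall i : nat, (i.+2 < m)%N -> s`_i - s`_i.+1 <= s`_i.+1 - s`_i.+2) ->
  (i <= j)%N -> (j + u < m)%N -> s`_i - s`_j <= s`_(i + u) - s`_(j + u).
Proof.
move=> gaps leij.
have gap_le a b : (a <= b)%N -> (b.+1 < m)%N ->
    s`_a - s`_a.+1 <= s`_b - s`_b.+1.
  elim: b => [|b IHb]; first by rewrite leqn0 => /eqP->.
  rewrite leq_eqVlt => /predU1P[->//|leab] ltbm.
  exact: le_trans (IHb leab (ltnW ltbm)) (gaps b ltbm).
elim: u => [|u IHu]; first by rewrite !addn0.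
rewrite !addnS => ltm; apply: le_trans (IHu (ltnW ltm)) _.
have := @gap_le (i + u)%N (j + u)%N; rewrite leq_add2r => /(_ leij ltm); lra.
Qed.

Lemma margin_le (T : finType) (X Y : {set T}) (m : nat) (s : m.-tuple int)
    (V : vote X) (W W' : vote (X :|: Y)) (x z : T) :
  #|X :|: Y| = m -> [disjoint X & Y] -> scoring_vector s ->
  (forall i : nat, (i.+2 < m)%N -> s`_i - s`_i.+1 <= s`_i.+1 - s`_i.+2) ->
  {in X &, forall a b, W a b = V a b} -> {in X &, forall a b, W' a b = V a b} ->
  {in Y, forall y, position W x < position W y <= position W x + #|Y|}%N ->
  x \in X -> z \in X ->
  s`_(position W' x) - s`_(position W' z) <= s`_(position W x) - s`_(position W z).
Proof.
move=> cardC dXY sV gaps eW eW' bW Xx Xz.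
have [->|nxz] := eqVneq x z; first by rewrite !subrr.
have C_X a : a \in X -> a \in X :|: Y by move=> Xa; rewrite inE Xa.
have C_Y a : a \in Y -> a \in X :|: Y by move=> Ya; rewrite inE Ya orbT.
have [rW aW tW oW] := voteP W; have [_ _ tW' _] := voteP W'.
have ltm U a : a \in X -> (position (U : vote (X :|: Y)) a < m)%N.
  by move=> Xa; rewrite -cardC position_lt_card ?C_X.
have Cx := C_X x Xx; have Cz := C_X z Xz.
(* In [W] every new candidate is below [x], hence below any [a] at or above [x], so such an [a] is
   not shifted. *)
have noY a : a \in X -> W a x -> position W a = position V a.
  move=> Xa Wax; rewrite (position_extension dXY eW Xa); apply/eqP.
  rewrite -[eqbRHS]addn0 eqn_add2l cards_eq0; apply/eqP/setP => y; rewrite !inE.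
  apply/negP => /andP[Yy Wya]; have Cy := C_Y y Yy.
  have Wyx := tW _ _ _ (C_X _ Xa) Cy Cx Wya Wax.
  have /andP[] := bW y Yy; rewrite position_ltP // => /andP[nxy Wxy] _.
  by case/eqP: nxy; apply: aW; rewrite // Wxy.
have Wx := noY x Xx (rW x Cx).
have W'x := position_extension dXY eW' Xx.
have W'z := position_extension dXY eW' Xz.
(* If [x] is above [z], then [W] shifts [x] by nothing and [z] by [#|Y|], the largest shift
   possible, so both scores move in favour of [x]. *)
have /orP[Wxz|Wzx] := oW x z Cx Cz.
  have ltxz : (position W x < position W z)%N by rewrite position_ltP ?nxz.
  have Wz : position W z = (position V z + #|Y|)%N.
    rewrite (position_extension dXY eW Xz); congr (_ + _)%N.
    apply: eq_card => y; rewrite inE; case Yy: (y \in Y) => //=.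
    by rewrite (right_below_block dXY Xx Xz bW ltxz).
  apply: lerB; apply: scoring_vector_le => //; rewrite ?ltm //.
    by rewrite Wx W'x leq_addr.
  rewrite Wz W'z leq_add2l; apply: subset_leq_card.
  by apply/subsetP => y; rewrite inE => /andP[].
have ltzx : (position W z < position W x)%N.
  by rewrite position_ltP // eq_sym nxz.
have Wz := noY z Xz Wzx.
(* As [W'] keeps [z] above [x], a new candidate above [z] is above [x] too. *)
have leuv : (#|[set y in Y | W' y z]| <= #|[set y in Y | W' y x]|)%N.
  apply: subset_leq_card; apply/subsetP => y.
  rewrite !inE => /andP[Yy W'yz]; rewrite Yy.
  by apply: (tW' _ _ _ Cz (C_Y _ Yy) Cx W'yz); rewrite eW' // -eW.
have lt' := ltm W' x Xx; rewrite {}W'x {}W'z Wx Wz in ltzx lt' *.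
move: leuv lt'; set u := #|_|; set v := #|_| => leuv lt'.
(* The shifts of [W'] are done in two stages: [z] and [x] together by [u], which cannot reduce the
   deficit of [x], then [x] alone by the remaining [v - u], which can only lower its score. *)
have shift := @gap_shift m s (position V z) (position V x) u gaps (ltnW ltzx).
have {}shift := shift (leq_ltn_trans (leq_add (leqnn _) leuv) lt').
have := @scoring_vector_le m s (position V x + u) (position V x + v) sV.
by rewrite leq_add2l => /(_ leuv lt'); lra.
Qed.

Theorem lemma6 (T : finType) (X Y : {set T}) (xstar : T) (p k n : nat)
    (n_gt0 : (0 < n)%N) (xstar_in : xstar \in X)
    (cardX : #|X| = p.+1) (cardY : #|Y| = k) (disjXY : [disjoint X & Y])
    (PX : profile n X) (s : (p + 1 + k).-tuple int)
    (s_scoring : scoring_vector s)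
    (s_gaps : forall i : nat, (i.+2 < p + 1 + k)%N ->
       s`_i - s`_i.+1 <= s`_i.+1 - s`_i.+2)
    (P : profile n (X :|: Y)) (P_below : put_right_below PX xstar P) :
  possible_cowinner PX (fun P' : profile n (X :|: Y) => scoring_rule s P') xstar
  <-> xstar \in scoring_rule s P.
Proof.
have [extP belowP] := P_below.
split=> [[P' [extP' winP']]|winP]; last by exists P.
have cardC : #|X :|: Y| = (p + 1 + k)%N.
  by move: disjXY; rewrite -leq_card_setU cardX cardY addn1 => /eqP.
have Cx : xstar \in X :|: Y by rewrite inE xstar_in.
rewrite inE Cx; apply/forallP => z; apply/implyP => Cz.
rewrite !(score_sum _ _ cardC) //.
have /orP[Xz|Yz] : (z \in X) || (z \in Y) by rewrite -in_setU.
  (* Winning in [P'] means that the margins over [z] have a nonnegative sum, and each of them is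
     bounded by the margin in the matching vote of [P]. *)
  move: winP'; rewrite inE Cx => /forallP/(_ z)/implyP/(_ Cz).
  rewrite !(score_sum _ _ cardC) // -subr_ge0 -sumrB => /le_trans le0.
  rewrite -subr_ge0 -sumrB; apply: le0; apply: ler_sum => i _.
  exact: (margin_le cardC disjXY s_scoring s_gaps (extP i) (extP' i) (belowP i)).
apply: ler_sum => i _; apply: (scoring_vector_le s_scoring).
  by have /andP[/ltnW] := belowP i z Yz.
by rewrite -cardC position_lt_card.
Qed.
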